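(* Let $k\geq 2$ be an integer, let $c_{k}=\sqrt{k(k-1)(k+2\sqrt{2k}+2)}$, and let $$p_{k}=\frac{5c_{k}^{2}+3c_{k}\sqrt{c_{k}^{2}+4k^{2}+8k+4}}{2}+k^{2}+2k+1.$$ Let $G$ be a connected graph of order $n\geq k+2$ with $\pi_{2}(G)\geq p_{k}n$. Then $G$ has a $[2,k]$-ST.
   Context: All graphs are finite and simple. For a graph $G$ and $u\in V(G)$, $d_G(u)$ is the degree of $u$. If $G$ is not complete, $\pi_{2}(G)=\min\{d_{G}(u)d_{G}(v): u,v\in V(G),\ u\neq v,\ uv\notin E(G)\}$; if $G$ is complete, $\pi_2(G)=\infty$. A $[2,k]$-ST of $G$ is a spanning tree $T$ of $G$ having no vertex whose degree in $T$ lies in $\{2,3,\dots,k\}$. *)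

(* Defs.v *)
From HB Require Import structures.
From mathcomp Require Import all_boot all_order all_algebra.
From mathcomp Require Export constructive_ereal.

Set Implicit Arguments.
Unset Strict Implicit.
Unset Printing Implicit Defensive.

Import Order.TTheory GRing.Theory Num.Theory.

Local Open Scope ring_scope.

Record sgraph (V : finType) := SGraph {
  adj :> rel V;
  adj_sym : symmetric adj;
  adj_irr : irreflexive adj
}.

Definition degree (V : finType) (G : sgraph V) (u : V) : nat :=
  #|[set v | G u v]|.

Definition connected (V : finType) (G : sgraph V) : Prop :=
  forall u v : V, connect G u v.

Definition acyclic (V : finType) (G : sgraph V) : Prop :=
  forall c : seq V, (2 < size c)%N -> ~ ucycle G c.

Definition is_tree (V : finType) (G : sgraph V) : Prop :=
  connected G /\ acyclic G.

(* Spanning is built into the type: both graphs have vertex set V. *)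
Definition spanning_tree (V : finType) (G S : sgraph V) : Prop :=
  subrel S G /\ is_tree S.

Definition is_2k_ST (V : finType) (k : nat) (G S : sgraph V) : Prop :=
  spanning_tree G S /\ forall v : V, ~ (2 <= degree S v <= k)%N.

(* When G is complete the range is empty and the value is +oo. *)
Definition pi2 (R : realDomainType) (V : finType) (G : sgraph V) : \bar R :=
  \big[Order.min/+oo%E]_(uv : V * V | (uv.1 != uv.2) && ~~ G uv.1 uv.2)
     ((degree G uv.1 * degree G uv.2)%N%:R)%:E.

Definition c_ (R : rcfType) (k : nat) : R :=
  Num.sqrt (k%:R * (k%:R - 1) * (k%:R + 2 * Num.sqrt (2 * k%:R) + 2)).

Definition p_ (R : rcfType) (k : nat) : R :=
  (5 * c_ R k ^+ 2
     + 3 * c_ R k * Num.sqrt (c_ R k ^+ 2 + 4 * k%:R ^+ 2 + 8 * k%:R + 4)) / 2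
  + k%:R ^+ 2 + 2 * k%:R + 1.

(* Main.v *)
(* If a vertex is adjacent to all others, a star is the required tree.
   Otherwise let u be a vertex of minimum degree d and D the least degree among
   its non-neighbours, so that d D >= 32 k (k - 1) n, since p_k >= 32 k (k - 1).

   Starting from the star at u, repeatedly let a vertex with many neighbours not
   yet reached (more than d/8 + k if it is adjacent to u, at least D/2
   otherwise) become a hub and take these neighbours as children.  Then let
   every other reached vertex with at least k unreached neighbours take them as
   children.  Double counting shows that few vertices stay isolated and that few
   hubs are non-neighbours of u; hence the forest obtained has so few components
   that joining them needs at most d/8 of the following repairs.  An edge x y of
   G between two components is added; if x then has degree 2, it receives
   k - 1 of its neighbours, each moved together with its subtree from its hub to
   x.  Moving a is forbidden only when x lies on the side of a in the forest
   minus the edge from a to its hub.  Such a are few: distinct ones have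
   distinct hubs, and if the hub itself is a child of u, it lies on the same
   side and is thus determined by u.  Every hub keeps degree at least k + 1. *)

Require Import Defs.
From HB Require Import structures.
From mathcomp Require Import all_boot all_order all_algebra.
From mathcomp Require Import zify lra.

Set Implicit Arguments.
Unset Strict Implicit.
Unset Printing Implicit Defensive.

Import Order.TTheory GRing.Theory Num.Theory.

(** * Edge operations and forests *)

Definition same_edge (V : finType) (x y : V) : rel V :=
  fun u v => ((u == x) && (v == y)) || ((u == y) && (v == x)).

Lemma same_edge_sym (V : finType) (x y : V) : symmetric (same_edge x y).
Proof. by move=> u v; rewrite /same_edge orbC andbC [(v == y) && _]andbC. Qed.

Definition add_edge_rel (V : finType) (F : sgraph V) (x y : V) : rel V :=
  fun u v => F u v || ((u != v) && same_edge x y u v).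

Lemma add_edge_sym (V : finType) (F : sgraph V) (x y : V) :
  symmetric (add_edge_rel F x y).
Proof.
by move=> u v; rewrite /add_edge_rel adj_sym eq_sym same_edge_sym.
Qed.

Lemma add_edge_irr (V : finType) (F : sgraph V) (x y : V) :
  irreflexive (add_edge_rel F x y).
Proof. by move=> u; rewrite /add_edge_rel adj_irr eqxx. Qed.

Definition add_edge (V : finType) (F : sgraph V) (x y : V) : sgraph V :=
  SGraph (@add_edge_sym V F x y) (@add_edge_irr V F x y).

Definition del_edge_rel (V : finType) (F : sgraph V) (x y : V) : rel V :=
  fun u v => F u v && ~~ same_edge x y u v.

Lemma del_edge_sym (V : finType) (F : sgraph V) (x y : V) :
  symmetric (del_edge_rel F x y).
Proof. by move=> u v; rewrite /del_edge_rel adj_sym same_edge_sym. Qed.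

Lemma del_edge_irr (V : finType) (F : sgraph V) (x y : V) :
  irreflexive (del_edge_rel F x y).
Proof. by move=> u; rewrite /del_edge_rel adj_irr. Qed.

Definition del_edge (V : finType) (F : sgraph V) (x y : V) : sgraph V :=
  SGraph (@del_edge_sym V F x y) (@del_edge_irr V F x y).

Lemma connectC (V : finType) (F : sgraph V) (u v : V) :
  connect F u v = connect F v u.
Proof. exact/sym_connect_sym/adj_sym. Qed.

Lemma connect_closed (V : finType) (e : rel V) (P : V -> Prop) (u v : V) :
  (forall x y, P x -> e x y -> P y) -> P u -> connect e u v -> P v.
Proof.
move=> cl Pu /connectP[p]; elim: p u Pu => [|x p IH] u Pu /=; first by move=> _ ->.
by case/andP=> eux; apply: IH; apply: cl eux.
Qed.

Lemma connect_subrel (V : finType) (e e' : rel V) (u v : V) :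
  subrel e e' -> connect e u v -> connect e' u v.
Proof. by move=> sub; apply: connect_sub => x y /sub/connect1. Qed.

Lemma connect_add_edge (V : finType) (F : sgraph V) (x y u v : V) :
  connect (add_edge F x y) u v ->
  [\/ connect F u v, connect F u x /\ connect F y v
    | connect F u y /\ connect F x v].
Proof.
apply: (@connect_closed _ _ (fun w => [\/ connect F u w,
  connect F u x /\ connect F y w | connect F u y /\ connect F x w]));
  last by constructor 1.
move=> a b /= H /orP[Fab|/andP[_ /orP[]/andP[/eqP ea /eqP eb]]].
- have ab := connect1 Fab.
  case: H => [ua|[ux ya]|[uy xa]].
  + by constructor 1; apply: connect_trans ab.
  + by constructor 2; split=> //; apply: connect_trans ab.
  + by constructor 3; split=> //; apply: connect_trans ab.
- rewrite {}ea {}eb in H *.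
  by case: H => [ua|[ux ya]|[uy xa]]; [constructor 2|constructor 2|constructor 1].
rewrite {}ea {}eb in H *.
by case: H => [ua|[ux ya]|[uy xa]]; [constructor 3|constructor 1|constructor 3].
Qed.

Lemma sub_add_edge (V : finType) (F : sgraph V) (x y : V) :
  subrel F (add_edge F x y).
Proof. by move=> u v /= uv; rewrite /add_edge_rel uv. Qed.

Lemma sub_del_edge (V : finType) (F : sgraph V) (x y : V) :
  subrel (del_edge F x y) F.
Proof. by move=> u v /= /andP[]. Qed.

Lemma connect_del_edge (V : finType) (F : sgraph V) (x y u v : V) :
  connect F u v ->
  [\/ connect (del_edge F x y) u v,
      connect (del_edge F x y) u x /\ connect (del_edge F x y) y v
    | connect (del_edge F x y) u y /\ connect (del_edge F x y) x v].
Proof.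
move=> uv; apply: connect_add_edge; apply: connect_subrel uv => a b /= Fab.
have nab : a != b by apply: contraTneq Fab => ->; rewrite adj_irr.
by rewrite /add_edge_rel /= /del_edge_rel Fab nab; case: (same_edge _ _ _ _).
Qed.

(** Every edge is a bridge. This form of acyclicity speaks only of [connect], so it is easy to
    follow through insertions and deletions of edges. *)
Definition forest (V : finType) (F : sgraph V) : Prop :=
  forall x y, F x y -> ~~ connect (del_edge F x y) x y.

Lemma forest_del_edge (V : finType) (F : sgraph V) (x y : V) :
  forest F -> forest (del_edge F x y).
Proof.
move=> fF u v /sub_del_edge/fF; apply: contra; apply: connect_subrel => a b /=.
by rewrite /del_edge_rel /= /del_edge_rel => /andP[/andP[-> _] ->].
Qed.

(** If an old edge u v stopped being a bridge, the detour around it would use the new edge x y;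
    together with u v it would already connect x and y in [F]. *)
Lemma forest_add_edge (V : finType) (F : sgraph V) (x y : V) :
  forest F -> ~~ connect F x y -> forest (add_edge F x y).
Proof.
move=> fF nxy u v uv; apply/negP => Cuv.
have [se|nse] := boolP (same_edge x y u v).
  have sub : subrel (del_edge (add_edge F x y) u v) F.
    move=> a b /=; rewrite /del_edge_rel /= /add_edge_rel.
    case/andP=> /orP[//|/andP[_ se']] /negP[].
    move: se => /orP[]/andP[/eqP-> /eqP->] //.
    by rewrite /same_edge orbC.
  have := connect_subrel sub Cuv.
  move: se => /orP[]/andP[/eqP-> /eqP->]; last rewrite connectC; exact/negP.
have Fuv : F u v by move: uv => /=; rewrite /add_edge_rel (negbTE nse) andbF orbF.
have {}Cuv : connect (add_edge (del_edge F u v) x y) u v.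
  apply: connect_subrel Cuv => a b /=.
  rewrite /add_edge_rel /= /del_edge_rel /= /add_edge_rel => /andP[/orP[->|->]].
    by move=> ->.
  by rewrite orbT.
have lift a b : connect (del_edge F u v) a b -> connect F a b.
  by apply: connect_subrel; apply: sub_del_edge.
have vu : connect F v u by rewrite connectC connect1.
case: (connect_add_edge Cuv) => [|[/lift ux /lift yv]|[/lift uy /lift xv]].
- exact/negP/fF.
- move/negP: nxy; apply; rewrite connectC.
  exact: connect_trans yv (connect_trans vu ux).
- move/negP: nxy; apply; exact: connect_trans xv (connect_trans vu uy).
Qed.

(** The rest of a cycle joins the ends of its first edge without using that edge, which is then not
    a bridge. *)
Lemma forest_acyclic (V : finType) (F : sgraph V) : forest F -> acyclic F.
Proof.
move=> fF [//|x [//|y [//|z p]]] _ /andP[].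
rewrite /= => /and3P[xy yz]; rewrite rcons_path => /andP[zp lx] /and3P[xn yn zn].
apply: (negP (fF _ _ xy)); rewrite connectC.
have [nxz nyz] : x != z /\ y != z.
  by move: xn yn; rewrite !inE !negb_or => /and3P[_ -> _] /andP[->].
have nxy : x != y by move: xn; rewrite !inE negb_or => /andP[].
have in_del a b : F a b -> b != x -> b != y -> del_edge F x y a b.
  move=> Fab bx yb; rewrite /= /del_edge_rel Fab /same_edge.
  by rewrite (negbTE bx) (negbTE yb) !andbF.
have all_zp : all (fun b => (b != x) && (b != y)) (z :: p).
  apply/allP => b bzp; apply/andP; split.
    by apply: contraNneq xn => <-; rewrite inE bzp orbT.
  by apply: contraNneq yn => <-.
apply: (@connect_trans _ _ z).
  by apply/connect1/in_del; rewrite // eq_sym.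
apply: (@connect_trans _ _ (last z p)).
  apply/connectP; exists p => //; apply: sub_in_path all_zp zp => a b _ /andP[bx yb] Fab.
  exact: in_del.
apply/connect1; rewrite /= /del_edge_rel lx /same_edge.
have /andP[lx' ly'] := allP all_zp _ (mem_last z p).
by rewrite (negbTE lx') (negbTE ly').
Qed.

Lemma degree_add_edge (V : finType) (F : sgraph V) (x y v : V) :
  x != y -> ~~ F x y ->
  degree (add_edge F x y) v = degree F v + (v == x) + (v == y).
Proof.
move=> nxy nF; rewrite /degree.
have nF' : ~~ F y x by rewrite adj_sym.
have [->|vx] := eqVneq v x.
  rewrite (negbTE nxy) addn0.
  have -> : [set w | add_edge F x y x w] = y |: [set w | F x w].
    apply/setP => w; rewrite !inE /= /add_edge_rel /same_edge eqxx (negbTE nxy) /= orbF orbC.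
    by case: (eqVneq w y) => [->|_]; rewrite ?andbF // nxy.
  by rewrite cardsU1 inE nF addnC.
have [->|vy] := eqVneq v y.
  rewrite addn0.
  have -> : [set w | add_edge F x y y w] = x |: [set w | F y w].
    apply/setP => w; rewrite !inE /= /add_edge_rel /same_edge eqxx.
    rewrite (eq_sym y x) (negbTE nxy) /= orbC.
    by case: (eqVneq w x) => [->|_]; rewrite ?andbF // eq_sym nxy.
  by rewrite cardsU1 inE nF' addnC.
rewrite !addn0; apply: eq_card => w; rewrite !inE /= /add_edge_rel /same_edge.
by rewrite (negbTE vx) (negbTE vy) andbF orbF.
Qed.

Lemma degree_del_edge (V : finType) (F : sgraph V) (x y v : V) :
  F x y -> degree (del_edge F x y) v + (v == x) + (v == y) = degree F v.
Proof.
move=> Fxy.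
have nxy : x != y by apply: contraTneq Fxy => ->; rewrite adj_irr.
rewrite -degree_add_edge //; last first.
  by rewrite /= /del_edge_rel /same_edge !eqxx /= andbF.
apply: eq_card => w; rewrite !inE /= /add_edge_rel /= /del_edge_rel.
have [se|_] /= := boolP (same_edge x y v w); last by rewrite andbF andbT orbF.
rewrite andbF andbT /=; move: se => /orP[]/andP[/eqP-> /eqP->]; first by rewrite nxy Fxy.
by rewrite eq_sym nxy adj_sym Fxy.
Qed.

(** * Linking the components of a forest *)

(* F has at most j connected components. *)
Definition has_reps (V : finType) (F : sgraph V) (j : nat) : Prop :=
  exists2 R : {set V}, #|R| <= j & forall v, exists2 r, r \in R & connect F v r.

Lemma has_reps_add_edge (V : finType) (F : sgraph V) (x y : V) (j : nat) :
  x != y -> ~~ connect F x y -> has_reps F j.+1 -> has_reps (add_edge F x y) j.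
Proof.
move=> nxy nc [R cR hR].
have [rx rxR xrx] := hR x; have [ry ryR yry] := hR y.
have lift a b : connect F a b -> connect (add_edge F x y) a b.
  exact/connect_subrel/sub_add_edge.
have nr : ry != rx.
  apply: contraNneq nc => e; rewrite e connectC in yry.
  exact: connect_trans xrx yry.
exists (R :\ rx) => [|v].
  by move: cR; rewrite (cardsD1 rx R) rxR.
have [r rR vr] := hR v; have [e|ne] := eqVneq r rx; last first.
  by exists r; [rewrite !inE ne | apply: lift].
exists ry; first by rewrite !inE nr.
rewrite {}e in vr; apply: connect_trans (lift _ _ vr) _.
apply: connect_trans (lift _ _ yry); rewrite connectC in xrx.
apply: connect_trans (lift _ _ xrx) (connect1 _).
by rewrite /= /add_edge_rel nxy /same_edge !eqxx orbT.
Qed.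

(** The representative of x stays connected to x or to y; the other end is added as a new
    representative. *)
Lemma has_reps_del_edge (V : finType) (F : sgraph V) (x y : V) (j : nat) :
  has_reps F j -> has_reps (del_edge F x y) j.+1.
Proof.
move=> [R cR hR].
suff [R' [cR' sRR' [rx rx' xrx] [ry ry' yry]]] : exists R' : {set V},
    [/\ #|R'| <= j.+1, R \subset R',
        exists2 r, r \in R' & connect (del_edge F x y) x r
      & exists2 r, r \in R' & connect (del_edge F x y) y r].
  exists R' => // v; have [r rR vr] := hR v.
  case: (connect_del_edge x y vr) => [c|[c _]|[c _]].
  - by exists r => //; apply: (subsetP sRR').
  - by exists rx => //; apply: connect_trans xrx.
  - by exists ry => //; apply: connect_trans yry.
have [r rR xr] := hR x.
have cU z : #|z |: R| <= j.+1 by rewrite cardsU1; case: (z \in R) => //=; lia.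
have : connect (del_edge F x y) x r \/ connect (del_edge F x y) y r.
  by case: (connect_del_edge x y xr) => [c|[_ c]|[_ c]]; [left|right|left].
case=> c; [exists (y |: R) | exists (x |: R)]; split; rewrite ?subsetUr //.
- by exists r; rewrite // !inE rR orbT.
- by exists y; rewrite ?connect0 // !inE eqxx.
- by exists x; rewrite ?connect0 // !inE eqxx.
- by exists r; rewrite // !inE rR orbT.
Qed.

(** The vertex x lies on the side of a and on the side of b, as seen from z. A path from x to a
    avoiding z a reaches neither z nor b, so it avoids z b too; with the edge a z it gives a detour
    around z b. *)
Lemma far_child_uniq (V : finType) (F : sgraph V) (x z a b : V) :
  forest F -> F z a -> F z b ->
  connect (del_edge F z a) x a -> connect (del_edge F z b) x b -> a = b.
Proof.
move=> fF za zb xa xb; apply/eqP; apply/negPn/negP => nab.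
have nz c : F z c -> z != c by apply: contraTneq => <-; rewrite adj_irr.
have in_del c d : F z c -> F z d -> c != d -> del_edge F z c z d.
  move=> zc zd ncd; rewrite /= /del_edge_rel zd /same_edge eqxx /=.
  by rewrite eq_sym (negbTE ncd) (negbTE (nz _ zc)).
have {in_del}[zb1 za2] : del_edge F z a z b /\ del_edge F z b z a.
  by split; apply: in_del; rewrite // eq_sym.
have /negP := fF _ _ za; have /negP := fF _ _ zb.
move=> nzb nza.
have nxz : ~ connect (del_edge F z a) x z.
  by rewrite connectC => zx; apply: nza; apply: connect_trans xa.
have nxb : ~ connect (del_edge F z a) x b.
  by move=> c; apply: nxz; apply: connect_trans c _; rewrite connectC connect1.
case: (connect_del_edge z b xa) => [c|[c _]|[c _]].
- apply: nzb; apply: connect_trans (connect1 za2) _.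
  apply: connect_trans xb; rewrite connectC.
  apply: connect_subrel c => v w /=; rewrite /del_edge_rel /= /del_edge_rel.
  by case/andP=> /andP[-> _] ->.
- by apply: nxz; apply: connect_subrel c; apply: sub_del_edge.
- by apply: nxb; apply: connect_subrel c; apply: sub_del_edge.
Qed.

(** The path from x to a in [F] minus z a meets neither z nor w, so it survives the deletion of w z
    and is prolonged by the edge a z. *)
Lemma far_parent (V : finType) (F : sgraph V) (x w z a : V) :
  forest F -> F z a -> F w z -> w != a ->
  connect (del_edge F z a) x a -> connect (del_edge F w z) x z.
Proof.
move=> fF za wz nwa xa; have /negP nza := fF _ _ za.
have nz c d : F c d -> c != d by apply: contraTneq => <-; rewrite adj_irr.
have wz1 : del_edge F z a w z.
  by rewrite /= /del_edge_rel wz /same_edge (negbTE nwa) (negbTE (nz _ _ wz)).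
have az2 : del_edge F w z a z.
  rewrite /= /del_edge_rel adj_sym za /same_edge eq_sym (negbTE nwa).
  by rewrite eq_sym (negbTE (nz _ _ za)).
have nxz : ~ connect (del_edge F z a) x z.
  by rewrite connectC => zx; apply: nza; apply: connect_trans xa.
have nxw : ~ connect (del_edge F z a) x w.
  by move=> c; apply: nxz; apply: connect_trans c (connect1 _).
case: (connect_del_edge w z xa) => [c|[c _]|[c _]].
- apply: connect_trans (connect1 az2).
  apply: connect_subrel c => v w' /=; rewrite /del_edge_rel /= /del_edge_rel.
  by case/andP=> /andP[-> _] ->.
- by case: nxw; apply: connect_subrel c; apply: sub_del_edge.
- by case: nxz; apply: connect_subrel c; apply: sub_del_edge.
Qed.

(* [M] is the set of hubs and [A] the set of vertices that may be moved away
   from their hub [par a]; a hub that may itself be moved hangs below [u]. *)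
Record hub_system (V : finType) (M A : {set V}) (par : V -> V) (u : V) : Prop :=
  HubSystem {
    hub_par : forall a, a \in A -> par a \in M;
    hub_root : u \notin A;
    hub_depth : forall a, a \in A -> par a \in A -> par (par a) = u }.

(* [B] is the set of vertices already moved. *)
Definition hub_state (V : finType) (G : sgraph V) (M A : {set V})
    (par : V -> V) (K : nat) (F : sgraph V) (B : {set V}) : Prop :=
  [/\ forest F, subrel F G,
      forall a, a \in A :\: B -> F (par a) a
    & forall z, z \in M -> K <= degree F z + #|B| ].

(** The unmoved vertices a that must not be moved to x: once a is cut from its hub, x is on the side
    of a, and the new edge x a would close a cycle. *)
Definition far_set (V : finType) (A : {set V}) (par : V -> V) (F : sgraph V)
    (B : {set V}) (x : V) : {set V} :=
  [set a in A :\: B | connect (del_edge F (par a) a) x a].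

(** By [far_child_uniq] it suffices to count the hubs of the far vertices. Such a hub lies outside
    [A], or was already moved, or hangs below [u]; in the last case it is itself far by
    [far_parent], and [u] has at most one far child. *)
Lemma card_far_set (V : finType) (G : sgraph V) (M A : {set V}) (par : V -> V)
    (u : V) (K : nat) (F : sgraph V) (B : {set V}) (x : V) :
  hub_system M A par u -> hub_state G M A par K F B ->
  #|far_set A par F B x| <= #|M :\: A| + #|B| + 1.
Proof.
move=> [hM hu hd] [fF _ hF _]; set X := far_set _ _ _ _ _.
have XA a : a \in X -> a \in A by rewrite !inE => /andP[/andP[]].
have XF a : a \in X -> F (par a) a by rewrite inE => /andP[/hF].
have Xc a : a \in X -> connect (del_edge F (par a) a) x a.
  by rewrite inE => /andP[].
have inj : {in X &, injective par}.
  move=> a b aX bX e; have := XF _ bX; have := Xc _ bX; rewrite -e => cb Fb.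
  exact: far_child_uniq (XF _ aX) Fb (Xc _ aX) cb.
rewrite -(card_in_imset inj).
pose Z := [set z in X | par z == u].
have cZ : #|Z| <= 1.
  apply/card_le1_eqP => y z; rewrite inE => /andP[yX /eqP ey].
  by rewrite inE => /andP[zX /eqP ez]; apply: inj; rewrite // ey ez.
apply: (@leq_trans #|(M :\: A) :|: B :|: Z|); last first.
  apply: leq_trans (leq_card_setU _ _) _; apply: leq_add cZ.
  exact: leq_card_setU.
apply/subset_leq_card/subsetP => z /imsetP[a aX ->].
have [aA pM] := (XA _ aX, hM _ (XA _ aX)).
rewrite inE [_ \in _ :|: B]inE [_ \in M :\: A]inE pM andbT.
have [pA|//] /= := boolP (par a \in A); have [//|pB] /= := boolP (par a \in B).
have pAB : par a \in A :\: B by rewrite inE pB.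
have epp := hd _ aA pA; rewrite inE epp eqxx andbT inE pAB /=.
apply: far_parent (XF _ aX) _ _ (Xc _ aX) => //; first exact: hF.
by rewrite epp; apply: contraNneq hu => ->.
Qed.

(** The neighbours of x that cannot be taken are those moved before, at most k already adjacent to
    x, and the far ones; the hypothesis leaves one more. Cutting it from its hub and joining it to x
    keeps the bound on the number of components and its own degree. *)
Lemma move_to (V : finType) (G : sgraph V) (M A : {set V}) (par : V -> V)
    (u : V) (K k j : nat) (F : sgraph V) (B : {set V}) (x : V) :
  hub_system M A par u -> hub_state G M A par K F B -> has_reps F j ->
  x \notin M -> degree F x <= k ->
  #|M :\: A| + #|B|.*2 + k + 1 < #|[set a in A | G x a]| ->
  exists F' B', [/\ hub_state G M A par K F' B', has_reps F' j, #|B'| = #|B|.+1,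
    degree F' x = (degree F x).+1
    & forall v, v \notin M -> v != x -> degree F' v = degree F v].
Proof.
move=> hs st rj xM dx big.
set X := [set a in A | G x a] in big.
pose N := [set a | F x a]; pose Y := far_set A par F B x.
have [a] : exists a, a \in X :\: (B :|: N :|: Y).
  apply/set0Pn; rewrite -card_gt0.
  have cN : #|N| <= k := dx.
  have cY : #|Y| <= _ := card_far_set x hs st.
  have h1 := (leq_card_setU (B :|: N) Y).1; have h2 := (leq_card_setU B N).1.
  have h3 := cardsID (B :|: N :|: Y) X.
  have h4 := subset_leq_card (subsetIr X (B :|: N :|: Y)).
  by move: big; rewrite -addnn; lia.
case: (hs) (st) => [hM hu hd] [fF sFG hF hK].
rewrite inE [in X in _ && X]inE inE inE !negb_or.
case/andP=> /andP[/andP[aB nFxa] nfar] /andP[aA Gxa].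
rewrite inE in nFxa.
have aAB : a \in A :\: B by rewrite inE aB.
have {}nfar : ~~ connect (del_edge F (par a) a) x a.
  by move: nfar; rewrite inE aAB.
have nxz : x != par a by apply: contraNneq xM => ->; apply: hM.
have nxa : x != a by apply: contraTneq Gxa => ->; rewrite adj_irr.
have Fza := hF _ aAB; set z := par a in nfar nxz Fza *.
have nza : z != a by apply: contraTneq Fza => ->; rewrite adj_irr.
have nDxa : ~~ del_edge F z a x a by apply: contra nFxa => /sub_del_edge.
have [F' [fF' sF' keep rj' dF']] : exists F' : sgraph V,
    [/\ forest F', subrel F' G, subrel (del_edge F z a) F', has_reps F' j
      & forall v, degree F' v + (v == z) = degree F v + (v == x)].
  exists (add_edge (del_edge F z a) x a); split.
  - by apply: forest_add_edge nfar; apply: forest_del_edge.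
  - move=> v w /= /orP[/sub_del_edge/sFG//|/andP[_ /orP[]/andP[/eqP-> /eqP->]]] //.
    by rewrite adj_sym.
  - exact: sub_add_edge.
  - by apply: has_reps_add_edge => //; apply: has_reps_del_edge.
  - move=> v; have := degree_del_edge v Fza; rewrite degree_add_edge //.
    by move=> <-; rewrite [LHS](ACl (1*4*3*2)%AC).
exists F', (a |: B); split=> //.
- split=> // [b|y yM].
    rewrite !inE negb_or -andbA => /and3P[nba bB bA].
    apply: keep; rewrite /= /del_edge_rel hF ?inE ?bB // /same_edge.
    (* The cut edge could be the one from b to its hub only in reversed roles: a is the hub of b and
       b that of a. Then [hub_depth] forces a = u, which is not in [A]. *)
    rewrite (negbTE nba) andbF /=; apply/negP => /andP[/eqP e1 /eqP e2].
    have : par (par a) = u by apply: hd => //; rewrite -/z -e2.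
    by rewrite -/z -e2 e1 => e; rewrite -e aA in hu.
  by have := dF' y; have := hK y yM; rewrite cardsU1 aB; clear; lia.
- by rewrite cardsU1 aB.
- by have := dF' x; rewrite eqxx (negbTE nxz); clear; lia.
- move=> v vM vx; have := dF' v; rewrite (negbTE vx).
  have /negbTE-> : v != z by apply: contraNneq vM => ->; apply: hM.
  by clear; lia.
Qed.

(** [S] is a budget for all moves ever made. As [B] never exceeds it, a single lower bound on the
    neighbours of x in [A] serves every move. *)
Lemma saturate (V : finType) (G : sgraph V) (M A : {set V}) (par : V -> V)
    (u : V) (K S k j i : nat) (F : sgraph V) (B : {set V}) (x : V) :
  hub_system M A par u -> hub_state G M A par K F B -> has_reps F j ->
  x \notin M -> #|M :\: A| + S.*2 + k <= #|[set a in A | G x a]| ->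
  degree F x + i = k.+1 -> #|B| + i <= S ->
  exists F' B', [/\ hub_state G M A par K F' B', has_reps F' j,
    #|B'| = #|B| + i, degree F' x = k.+1
    & forall v, v \notin M -> v != x -> degree F' v = degree F v].
Proof.
move=> hs + + xM big; elim: i F B => [|i IH] F B st rj dx cB.
  by exists F, B; rewrite addn0; split=> //; rewrite -dx addn0.
have [||F1 [B1 [st1 rj1 cB1 dx1 dv1]]] := @move_to _ _ _ _ _ _ _ k _ _ _ x hs st rj xM.
- by lia.
- by move: big; rewrite -!addnn; lia.
have [||F2 [B2 [st2 rj2 cB2 dx2 dv2]]] := IH F1 B1 st1 rj1; [lia|lia|].
exists F2, B2; split=> // [|v vM vx]; first by lia.
by rewrite dv2 // dv1.
Qed.

(** A degree between 2 and k reaches k + 1 after at most k - 1 moves; in all other cases, and for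
    hubs, nothing is done. *)
Lemma repair_degree (V : finType) (G : sgraph V) (M A : {set V}) (par : V -> V)
    (u : V) (K S k j : nat) (F : sgraph V) (B : {set V}) (x : V) :
  hub_system M A par u -> hub_state G M A par K F B -> has_reps F j ->
  (x \notin M -> #|M :\: A| + S.*2 + k <= #|[set a in A | G x a]|) ->
  #|B| + k.-1 <= S ->
  exists F' B', [/\ hub_state G M A par K F' B', has_reps F' j,
    #|B'| <= #|B| + k.-1, x \notin M -> ~~ (2 <= degree F' x <= k)
    & forall v, v \notin M -> v != x -> degree F' v = degree F v].
Proof.
move=> hs st rj big cB.
have [/andP[xM /andP[d2 dk]]|ok] := boolP ((x \notin M) && (2 <= degree F x <= k)).
  have [||F' [B' [st' rj' cB' dx' dv']]] :=
    @saturate _ _ _ _ _ _ _ S k _ (k.+1 - degree F x) _ _ _ hs st rj xM (big xM).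
  - by lia.
  - by lia.
  by exists F', B'; split=> //; [lia | rewrite dx' ltnn andbF].
by exists F, B; split=> //; [lia | move: ok; case: (x \in M)].
Qed.

Lemma disconnected_edge (V : finType) (G F : sgraph V) (u v : V) :
  connected G -> ~~ connect F u v -> exists x y, G x y /\ ~~ connect F x y.
Proof.
move=> cG nuv.
have [/existsP[x /existsP[y /andP[xy nxy]]]|none] :=
  boolP [exists x, exists y, G x y && ~~ connect F x y]; first by exists x, y.
case/negP: nuv; apply: connect_sub (cG u v) => x y xy.
by apply: contraR none => nxy; apply/existsP; exists x; apply/existsP; exists y; rewrite xy.
Qed.

(** Joining j + 1 components takes j edges, each with two ends to repair, hence at most 2 (k - 1) j
    moves. A hub starts with degree at least S + k + 1 and loses at most S, so it ends above k. *)
Lemma link_components (V : finType) (G : sgraph V) (M A : {set V})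
    (par : V -> V) (u : V) (S k j : nat) (F : sgraph V) (B : {set V}) :
  1 < k -> connected G -> hub_system M A par u ->
  (forall x, x \notin M -> #|M :\: A| + S.*2 + k <= #|[set a in A | G x a]|) ->
  hub_state G M A par (S + k.+1) F B -> has_reps F j.+1 ->
  #|B| + (k.-1 * j).*2 <= S ->
  (forall v, v \notin M -> ~~ (2 <= degree F v <= k)) ->
  exists T : sgraph V, is_2k_ST k G T.
Proof.
move=> k1 cG hs big.
have finish F0 B0 : hub_state G M A par (S + k.+1) F0 B0 -> #|B0| <= S ->
    (forall v, v \notin M -> ~~ (2 <= degree F0 v <= k)) -> connected F0 ->
    exists T : sgraph V, is_2k_ST k G T.
  move=> [fF sF _ hK] cB ok cF.
  exists F0; split=> [|v]; first by do 2!split=> //; apply: forest_acyclic.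
  apply/negP; have [vM|vM] := boolP (v \in M); last exact: ok.
  by have := hK v vM; lia.
elim: j F B => [|j IH] F B st rj cB ok.
  apply: finish st _ ok _; first exact: leq_trans (leq_addr _ _) cB.
  case: rj => R cR hR x y; have [r rR xr] := hR x; have [r' r'R yr] := hR y.
  have e : r = r' by have /card_le1_eqP := cR; apply.
  by rewrite -e connectC in yr; apply: connect_trans xr yr.
have [/existsP[x0 /existsP[y0 nxy0]]|allc] :=
  boolP [exists x, exists y, ~~ connect F x y]; last first.
  apply: finish st _ ok _ => [|x y]; first exact: leq_trans (leq_addr _ _) cB.
  apply: contraR allc => nxy.
  by apply/existsP; exists x; apply/existsP; exists y.
have [x [y [Gxy nc]]] := disconnected_edge cG nxy0.
have nxy : x != y by apply: contraTneq Gxy => ->; rewrite adj_irr.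
have nF : ~~ F x y by apply: contra nc; apply: connect1.
have [fF sF hF hK] := st.
have st1 : hub_state G M A par (S + k.+1) (add_edge F x y) B.
  split.
  - exact: forest_add_edge.
  - move=> v w /= /orP[/sF//|/andP[_ /orP[]/andP[/eqP-> /eqP->]]] //.
    by rewrite adj_sym.
  - by move=> a /hF; apply: sub_add_edge.
  - by move=> z /hK; rewrite degree_add_edge //; lia.
have rj1 := has_reps_add_edge nxy nc rj.
have cB' : #|B| + k.-1 + k.-1 + (k.-1 * j).*2 <= S.
  by move: cB; rewrite mulnS doubleD -addnn; lia.
have cB'' := leq_trans (leq_addr _ _) cB'.
have [|F2 [B2 [st2 rj2 cB2 dx2 dv2]]] :=
  @repair_degree _ _ _ _ _ _ _ S k _ _ _ x hs st1 rj1 (big x); first by lia.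
(* A move changes the degree only of a hub and of the receiving vertex, so repairing y does not
   spoil the repair of x. *)
have [|F3 [B3 [st3 rj3 cB3 dy3 dv3]]] :=
  @repair_degree _ _ _ _ _ _ _ S k _ _ _ y hs st2 rj2 (big y); first by lia.
apply: (IH F3 B3) => // [|v vM]; first by lia.
have [e|vy] := eqVneq v y; first by rewrite e in vM *; apply: dy3.
rewrite dv3 //; have [e|vx] := eqVneq v x; first by rewrite e in vM *; apply: dx2.
by rewrite dv2 // degree_add_edge // (negbTE vx) (negbTE vy) !addn0; apply: ok.
Qed.

(** * Forests of parent functions and the greedy construction *)

Definition parent_rel (V : finType) (f : V -> V) : rel V :=
  fun u v => (u != v) && ((f u == v) || (f v == u)).

Lemma parent_rel_sym (V : finType) (f : V -> V) : symmetric (parent_rel f).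
Proof. by move=> u v; rewrite /parent_rel eq_sym orbC. Qed.

Lemma parent_rel_irr (V : finType) (f : V -> V) : irreflexive (parent_rel f).
Proof. by move=> u; rewrite /parent_rel eqxx. Qed.

(* The graph of a parent function; a root is a vertex with [f v = v]. *)
Definition parent_graph (V : finType) (f : V -> V) : sgraph V :=
  SGraph (@parent_rel_sym V f) (@parent_rel_irr V f).

(** The rank excludes all cycles of [f] except fixed points. *)
Definition ranked (V : finType) (f : V -> V) : Prop :=
  exists rk : V -> nat, forall v, f v != v -> rk (f v) < rk v.

Definition children (V : finType) (f : V -> V) (v : V) : {set V} :=
  [set b | (b != v) && (f b == v)].

(** For an edge from x to its parent y, the vertices whose [f]-orbit meets x are closed under all
    other edges, and y is not among them because its rank is smaller. *)
Lemma forest_parent_graph (V : finType) (f : V -> V) :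
  ranked f -> forest (parent_graph f).
Proof.
move=> [rk hrk].
have up x y : x != y -> f x = y -> ~~ connect (del_edge (parent_graph f) x y) x y.
  move=> nxy fx; apply/negP => xy.
  suff : fconnect f y x.
    have mono z : fconnect f y z -> rk z <= rk y.
      apply: (@connect_closed _ _ (fun z => rk z <= rk y)) => // a b ha /eqP<-.
      have [->//|na] := eqVneq (f a) a.
      exact: leq_trans (ltnW (hrk _ na)) ha.
    by move=> /mono; rewrite leqNgt -fx hrk // fx eq_sym.
  apply: (@connect_closed _ _ (fun z => fconnect f z x) _ _ _ _ xy); last first.
    exact: connect0.
  move=> a b fa /= /andP[/andP[nab /orP[/eqP e|/eqP e]] nse]; last first.
    by apply: connect_trans fa; rewrite -e fconnect1.
  case/connectP: fa => [[|c p]] /=.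
    by move=> _ ea; rewrite /same_edge -e -ea fx !eqxx in nse.
  by case/andP=> /eqP ec pc lx; apply/connectP; exists p; rewrite // -e ec.
move=> x y /= /andP[nxy /orP[/eqP e|/eqP e]]; first exact: up.
have := up y x; rewrite eq_sym => /(_ nxy e); apply: contra; rewrite connectC.
by apply: connect_subrel => a b /=; rewrite /del_edge_rel /same_edge orbC.
Qed.

Lemma has_reps_parent_graph (V : finType) (f : V -> V) (j : nat) :
  ranked f -> #|[set v | f v == v]| <= j -> has_reps (parent_graph f) j.
Proof.
move=> [rk hrk] cj; exists [set v | f v == v] => // v.
have [n] := ubnP (rk v); elim: n v => // n IH v ltn.
have [fv|fv] := eqVneq (f v) v; first by exists v; rewrite ?inE ?fv.
have [|r rR c] := IH (f v); first exact: leq_trans (hrk _ fv) _.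
exists r => //; apply: connect_trans c; apply: connect1.
by rewrite /= /parent_rel eqxx eq_sym fv.
Qed.

Lemma degree_parent_graph (V : finType) (f : V -> V) (v : V) :
  ranked f -> degree (parent_graph f) v = #|children f v| + (f v != v).
Proof.
move=> [rk hrk]; rewrite /degree.
have [fv|fv] := eqVneq (f v) v.
  rewrite addn0; apply: eq_card => b; rewrite !inE /= /parent_rel fv eq_sym.
  by case: eqVneq.
have nin : f v \notin children f v.
  rewrite inE fv; apply/eqP => e; have := hrk _ fv; have := hrk (f v).
  by rewrite e eq_sym fv => /(_ isT) /ltn_trans h /h; rewrite ltnn.
transitivity #|f v |: children f v|; last by rewrite cardsU1 nin addnC.
apply: eq_card => b; rewrite !inE /= /parent_rel [v == b]eq_sym [b == f v]eq_sym.
by have [->|] := eqVneq b v; rewrite // (negbTE fv).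
Qed.

(* A stage of the greedy process: [W] is the set of vertices of [W0] not yet
   reached, [N] the set of hubs chosen so far. *)
Record greedy_stage (V : finType) (G : sgraph V) (f0 : V -> V) (W0 C : {set V})
    (tau : V -> nat) (f : V -> V) (W N : {set V}) : Prop := GreedyStage {
  greedy_ranked : ranked f;
  greedy_unreached : W \subset W0;
  greedy_hubs : N \subset C;
  greedy_disjoint : forall v, v \in N -> v \notin W;
  greedy_old : forall v, v \notin W0 -> f v = f0 v;
  greedy_root : forall w, w \in W -> f w = w;
  greedy_nonroot : forall w, w \in W0 -> w \notin W -> w \notin N -> f w != w;
  greedy_parent : forall w, w \in W0 -> f w != w -> f w \in N /\ G (f w) w;
  greedy_children : forall v, v \in N -> tau v <= #|children f v|;
  greedy_nonadj : forall v w, v \in N -> w \in W -> ~~ G v w }.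

(** The new hub v is removed from [W] as well, since it may itself be unreached; it then remains a
    root. *)
Lemma greedy_step (V : finType) (G : sgraph V) (f0 : V -> V) (W0 C : {set V})
    (tau : V -> nat) (f : V -> V) (W N : {set V}) (v : V) :
  (forall x, f0 x != x -> f0 x \notin W0) ->
  greedy_stage G f0 W0 C tau f W N -> v \in C ->
  tau v <= #|[set w in W | G v w]| ->
  greedy_stage G f0 W0 C tau
    (fun b => if b \in [set w in W | G v w] then v else f b)
    (W :\: (v |: [set w in W | G v w])) (v |: N).
Proof.
move=> hf0 [[rk hrk] sW sN dNW old root nonroot parent chil nonadj] vC.
set X := [set w in W | G v w] => tX.
have XW w : w \in X -> w \in W by rewrite inE => /andP[].
have XG w : w \in X -> G v w by rewrite inE => /andP[].
have vX : v \notin X by rewrite inE adj_irr andbF.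
have fW c : f c != c -> f c \notin W.
  move=> fc; have [cW0|cW0] := boolP (c \in W0).
    by have [/dNW] := parent c cW0 fc.
  by rewrite old // in fc *; apply: contra (hf0 c fc); apply: (subsetP sW).
split.
(* No vertex of [W] is the parent of another vertex, so changing the ranks on [X] disturbs nothing
   else. *)
- exists (fun b => if b \in X then (rk v).+1 else rk b) => c.
  have [cX|cX] := boolP (c \in X); first by rewrite (negbTE vX).
  move=> fc; have /negbTE-> : f c \notin X by apply: contra (fW c fc); apply: XW.
  exact: hrk.
- exact: subset_trans (subsetDl _ _) sW.
- by rewrite subUset sub1set vC.
- move=> x; rewrite !inE => /orP[->//|/dNW/negbTE->].
  by rewrite andbF.
- move=> x xW0; rewrite ifN ?old //; apply: contra xW0 => /XW.
  exact: (subsetP sW).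
- move=> w; rewrite in_setD !in_setU1 negb_or => /andP[/andP[_ /negbTE->]].
  exact: root.
- move=> w wW0; rewrite in_setD !in_setU1 !negb_or => nw /andP[wv wN].
  have [wX|wX] := boolP (w \in X); first by rewrite eq_sym.
  by apply: nonroot => //; move: nw; rewrite (negbTE wv) (negbTE wX).
- move=> w wW0; have [wX _|wX fw] := boolP (w \in X).
    by rewrite !inE eqxx XG.
  by have [fN Gf] := parent w wW0 fw; rewrite in_setU1 fN orbT.
- move=> x; rewrite in_setU1; have [->|xv] /= := eqVneq x v => xN.
    apply: leq_trans tX _; apply/subset_leq_card/subsetP => b bX.
    by rewrite inE bX eqxx andbT; apply: contraNneq vX => <-.
  apply: leq_trans (chil x xN) _; apply/subset_leq_card/subsetP => b.
  rewrite !inE => /andP[bx /eqP fb]; rewrite bx.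
  have bW : b \notin W by apply: contraNN bx => /root <-; rewrite fb.
  by rewrite (negbTE bW) /= fb.
- move=> x w; rewrite in_setU1 in_setD in_setU1 negb_or => xN /andP[/andP[wv wX] wW].
  case/orP: xN => [/eqP->|xN]; last exact: nonadj.
  by apply: contra wX => Gw; rewrite inE wW.
Qed.

(** Every step removes at least one vertex from [W], as [tau] is positive; when no step is possible,
    each candidate that is not a hub has few unreached neighbours. *)
Lemma greedy_complete (V : finType) (G : sgraph V) (f0 : V -> V)
    (W0 C : {set V}) (tau : V -> nat) :
  ranked f0 -> (forall w, w \in W0 -> f0 w = w) ->
  (forall x, f0 x != x -> f0 x \notin W0) -> (forall v, 0 < tau v) ->
  exists f W N, greedy_stage G f0 W0 C tau f W N /\
    (forall v, v \in C -> v \notin N -> #|[set w in W | G v w]| < tau v).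
Proof.
move=> rf0 root0 hf0 tau0.
have start : greedy_stage G f0 W0 C tau f0 W0 set0.
  split=> //; rewrite ?sub0set //.
  - by move=> v; rewrite inE.
  - by move=> w wW /negP[].
  - by move=> w /root0 ->; rewrite eqxx.
  - by move=> v; rewrite inE.
  - by move=> v w; rewrite inE.
suff gen n (f : V -> V) (W N : {set V}) : #|W| < n -> greedy_stage G f0 W0 C tau f W N ->
    exists f W N, greedy_stage G f0 W0 C tau f W N /\
      (forall v, v \in C -> v \notin N -> #|[set w in W | G v w]| < tau v).
  exact: (gen #|W0|.+1) start.
elim: n f W N => // n IH f W N ltn st.
have [/existsP[v /andP[vC tv]]|none] :=
  boolP [exists v, (v \in C) && (tau v <= #|[set w in W | G v w]|)]; last first.
  exists f, W, N; split=> // v vC vN; rewrite ltnNge; apply: contra none => tv.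
  by apply/existsP; exists v; rewrite vC.
apply: IH (greedy_step hf0 st vC tv).
apply: leq_trans (_ : #|W| <= n); last by [].
apply/proper_card/properP; split; first exact: subsetDl.
have /card_gt0P[w] := leq_trans (tau0 v) tv; rewrite inE => /andP[wW Gw].
by exists w; rewrite // !inE wW Gw orbT.
Qed.

(** * Counting children and edges *)

Lemma sum_card_children (V : finType) (f : V -> V) (D : {set V}) :
  \sum_(v in D) #|children f v| <= #|V|.
Proof.
have -> : #|V| = \sum_(v : V) #|[set b | f b == v]|.
  rewrite -sum1_card (partition_big f xpredT) //; apply: eq_bigr => v _.
  by rewrite -sum1_card; apply: eq_bigl => b; rewrite !inE.
rewrite [X in _ <= X](bigID (mem D)) /=; apply: leq_trans (leq_addr _ _).
apply: leq_sum => v _; apply/subset_leq_card/subsetP => b.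
by rewrite !inE => /andP[].
Qed.

Lemma double_count (V : finType) (G : sgraph V) (X Y : {set V}) (a b : nat) :
  (forall x, x \in X -> a <= #|[set y in Y | G x y]|) ->
  (forall y, y \in Y -> #|[set x in X | G y x]| <= b) -> #|X| * a <= #|Y| * b.
Proof.
move=> hX hY; rewrite -!sum_nat_const.
apply: (@leq_trans (\sum_(x in X) \sum_(y in Y) G x y)).
  apply: leq_sum => x xX; apply: leq_trans (hX x xX) _.
  by rewrite -sum1_card -big_mkcondr; under eq_bigl do rewrite inE.
rewrite exchange_big; apply: leq_sum => y yY; apply: leq_trans (hY y yY).
rewrite -sum1_card -big_mkcondr; under [X in _ <= X]eq_bigl do rewrite inE.
by under eq_bigl do rewrite adj_sym.
Qed.

Lemma degree_lt (V : finType) (G : sgraph V) (v : V) : degree G v < #|V|.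
Proof.
rewrite /degree -cardsT; apply/proper_card/properP; split; first exact: subsetT.
by exists v; rewrite // inE adj_irr.
Qed.

(** * Spanning trees from a lower bound on degree products *)

Lemma ranked_star (V : finType) (P : pred V) (u : V) :
  ranked (fun b => if P b then u else b).
Proof.
exists (fun b => nat_of_bool (b != u)) => v.
by case: ifP => _; rewrite eqxx // eq_sym => ->.
Qed.

Lemma dominating_2k_ST (V : finType) (G : sgraph V) (k : nat) (u : V) :
  k + 2 <= #|V| -> (forall v, v != u -> G u v) ->
  exists T : sgraph V, is_2k_ST k G T.
Proof.
move=> cV dom; pose f := fun _ : V => u.
have rf : ranked f by apply: (ranked_star xpredT).
exists (parent_graph f); split; [split|].
- move=> x y /= /andP[nxy /orP[]/eqP e]; rewrite -e in nxy *; last by rewrite dom // eq_sym.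
  by rewrite adj_sym dom.
- split; last exact/forest_acyclic/forest_parent_graph.
  have to_u x : connect (parent_graph f) x u.
    have [->//|nx] := eqVneq x u.
    by apply: connect1; rewrite /= /parent_rel nx eqxx.
  by move=> x y; apply: connect_trans (to_u x) _; rewrite connectC.
- move=> v; rewrite degree_parent_graph //.
  have [->|nv] := eqVneq v u.
    have -> : children f u = [set~ u].
      by apply/setP => b; rewrite !inE eqxx andbT.
    by rewrite cardsC1; case: (f u != u); clear -cV; lia.
  have -> : children f v = set0.
    by apply/setP => b; rewrite !inE /f [u == v]eq_sym (negbTE nv) andbF.
  by rewrite cards0; case: (f v != v).
Qed.

(** Here m counts the hubs not adjacent to [u] and r the vertices left isolated. The two counts give
    (m + r) D <= 2 k n. The constant 32 is 8 for the budget d/8, times 2 for the two ends of a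
    linking edge, times 2 for halving D. *)
Lemma hub_arith (k n d D m r : nat) :
  1 < k -> 32 * (k * k.-1) * n <= d * D -> 32 * (k * k.-1) < d -> d <= D ->
  m * uphalf D <= n -> r * (D - uphalf D).+1 <= n * k.-1 ->
  [/\ (k.-1 * (m + r)).*2 <= d %/ 8, 32 * m <= d & 32 * k < d].
Proof.
case: k => [//|q] /=; rewrite ltnS => q0 hP hd dD hm hr.
have D0 : 0 < D := leq_trans (leq_ltn_trans (leq0n _) hd) dD.
have mD : m * D <= 2 * n.
  have D2 : D <= 2 * uphalf D by lia.
  apply: leq_trans (leq_mul (leqnn m) D2) _.
  by rewrite mulnCA leq_mul2l.
have rD : r * D <= 2 * (n * q).
  have D2 : D <= 2 * (D - uphalf D).+1 by lia.
  apply: leq_trans (leq_mul (leqnn r) D2) _.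
  by rewrite mulnCA leq_mul2l.
have hm' : 16 * (q.+1 * q) * m <= d.
  rewrite -(leq_pmul2r D0); apply: leq_trans hP; rewrite -mulnA.
  apply: leq_trans (leq_mul (leqnn _) mD) _.
  by rewrite mulnA leq_mul2r [16 * _ * 2]mulnAC leqnn orbT.
have hr' : 16 * q * (m + r) <= d.
  rewrite -(leq_pmul2r D0); apply: leq_trans hP; rewrite -mulnA mulnDl.
  apply: leq_trans (leq_mul (leqnn _) (leq_add mD rD)) _.
  have -> : 2 * n + 2 * (n * q) = 2 * (q.+1 * n).
    by rewrite -mulnDr -mulnS mulnC [q.+1 * n]mulnC mulnC.
  by rewrite [16 * q * _](_ : _ = 32 * (q.+1 * q) * n) // !mulnA; lia.
split.
- by rewrite leq_divRL // (_ : (q * (m + r)).*2 * 8 = 16 * q * (m + r)) //; lia.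
- apply: leq_trans hm'; rewrite leq_mul2r; apply/orP; right.
  by rewrite (leq_mul2l 16 2); apply: (@leq_mul 2 1).
- apply: leq_ltn_trans hd; rewrite leq_mul2l /=.
  by rewrite -{1}[q.+1]muln1 leq_mul2l q0 orbT.
Qed.

Lemma product_2k_ST (V : finType) (G : sgraph V) (k : nat) :
  1 < k -> connected G -> k + 2 <= #|V| ->
  (forall x y, x != y -> ~~ G x y ->
     32 * (k * k.-1) * #|V| <= degree G x * degree G y) ->
  exists T : sgraph V, is_2k_ST k G T.
Proof.
move=> k1 cG cV prod.
have [/existsP[v /forallP dom]|nodom] :=
  boolP [exists v, [forall w, (w != v) ==> G v w]].
  by apply: (@dominating_2k_ST _ _ _ v) => // w; apply/implyP.
have [x0 _] : exists x0 : V, true.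
  by have /card_gt0P[x0] : 0 < #|V| by [lia]; exists x0.
case: (@arg_minnP _ x0 xpredT (degree G)) => // u _ umin.
pose H := [set v | (v != u) && ~~ G u v].
have [h0 h0H] : exists h0, h0 \in H.
  move: nodom; rewrite negb_exists => /forallP/(_ u); rewrite negb_forall.
  by case/existsP=> h0; rewrite negb_imply => hh; exists h0; rewrite inE.
case: (@arg_minnP _ h0 (mem H) (degree G)) => // h hH hmin {x0 h0 h0H nodom}.
have {}hH : h \in H := hH.
have umin' v : degree G u <= degree G v by apply: umin.
have hmin' v : v \in H -> degree G h <= degree G v by apply: hmin.
have hP : 32 * (k * k.-1) * #|V| <= degree G u * degree G h.
  by move: hH; rewrite inE eq_sym => /andP[]; apply: prod.
(* Since D < n, a product d D of at least 32 k (k - 1) n needs d > 32 k (k - 1). *)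
have hd : 32 * (k * k.-1) < degree G u.
  have p0 : 0 < 32 * (k * k.-1) by rewrite muln_gt0; case: (k) k1 => [|[]].
  move: (32 * (k * k.-1)) p0 hP => p p0 hP.
  rewrite ltnNge; apply/negP => le; have := leq_trans hP (leq_mul le (leqnn _)).
  by rewrite (leq_pmul2l p0) leqNgt degree_lt.
have Hdef v : (v \in H) = (v != u) && ~~ G u v by rewrite inE.
have uH : u \notin H by rewrite Hdef eqxx.
have GH v : G u v -> v \notin H by rewrite Hdef => ->; rewrite andbF.
have notH v : v \notin H -> v != u -> G u v.
  by rewrite Hdef => + nv; rewrite nv negbK.
clearbody H; move: (umin') (hmin') hP hd => {umin hmin}.
have [d ed] : exists d, d = degree G u by exists (degree G u).
have [D eD] : exists D, D = degree G h by exists (degree G h).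
have dD : d <= D by rewrite ed eD.
rewrite -ed -eD => umin hmin hP hd.
(* [S] is the budget of moves. A hub adjacent to [u] gets at least S + k + 1 children, so k + 1
   remain after S losses. The threshold [s] for the other hubs is at least as large and keeps their
   number small. *)
pose S := d %/ 8; pose t := S + k.+1; pose s := uphalf D.
have d0 : 0 < d := leq_ltn_trans (leq0n _) hd.
pose tau v := if G u v then t else s.
have tau0 v : 0 < tau v.
  by rewrite /tau /t /s; case: ifP => _; [rewrite addnS | rewrite uphalf_gt0 (leq_trans d0)].
pose f0 b := if G u b then u else b.
have [|w wH|x|//|f1 [W1 [N1 [st1 max1]]]] :=
  @greedy_complete V G f0 H (~: [set u]) tau.
- exact: ranked_star.
- by rewrite /f0 ifN //; move: wH; apply: contraL => /GH.
- by rewrite /f0; case: ifP; rewrite ?eqxx.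
case: (st1) => rk1 W1H N1u dis1 old1 root1 nonroot1 par1 chil1 nadj1.
have N1nu v : v \in N1 -> v != u by move/(subsetP N1u); rewrite !inE.
have uW1 : u \notin W1 by apply: contra uH; apply: (subsetP W1H).
have f1u v : G u v -> f1 v = u by move=> Gv; rewrite old1 ?GH // /f0 Gv.
have f1uu : f1 u = u by rewrite old1 // /f0 adj_irr.
pose M := u |: N1.
have f1M x : f1 x != x -> f1 x \in M /\ G (f1 x) x.
  have [xH|xH] := boolP (x \in H).
    by move=> fx; have [? ?] := par1 x xH fx; rewrite inE; split=> //; apply/orP; right.
  have [->|xu] := eqVneq x u; first by rewrite f1uu eqxx.
  by have Gx := notH _ xH xu; rewrite f1u // !inE eqxx.
have MW1 v : v \in M -> v \notin W1 by rewrite !inE => /orP[/eqP->|/dis1].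
(* Second round: only reached vertices that are not hubs take children. The threshold k suffices, as
   such a vertex also has a parent. *)
pose C2 := ~: (W1 :|: M).
have [//|w wW|x fx|//|f2 [W2 [N2 [st2 max2]]]] :=
  @greedy_complete V G f1 W1 C2 (fun=> k).
- exact: root1.
- by have [/MW1] := f1M _ fx.
- by move=> _; apply: ltnW.
case: (st2) => rk2 W2W1 N2C dis2 old2 root2 nonroot2 par2 chil2 nadj2.
have N2W1 v : v \in N2 -> v \notin W1.
  by move/(subsetP N2C); rewrite !inE negb_or => /andP[].
have N2M v : v \in N2 -> v \notin M.
  by move/(subsetP N2C); rewrite in_setC in_setU negb_or => /andP[].
pose Q := N1 :&: H.
have QN1 v : v \in N1 -> v \notin Q -> G u v.
  by move=> vN; rewrite inE vN /= => vH; apply: notH => //; apply: N1nu.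
have [hm [hm32 hk32]] : (k.-1 * (#|Q| + #|W2|)).*2 <= S /\ (32 * #|Q| <= d /\ 32 * k < d).
  suff [? ? ?] : [/\ (k.-1 * (#|Q| + #|W2|)).*2 <= S, 32 * #|Q| <= d & 32 * k < d] by [].
  apply: hub_arith hP hd dD _ _ => //.
    apply: leq_trans (sum_card_children f1 Q); rewrite -sum_nat_const.
    apply: leq_sum => v; rewrite inE => /andP[vN vH]; apply: leq_trans (chil1 v vN).
    by rewrite /tau ifN //; apply: contraL vH; apply: GH.
  apply: (@leq_trans (#|C2| * k.-1)); last by rewrite leq_mul2r max_card orbT.
  (* A vertex of [W2] has at least D neighbours, none in [M], and fewer than [s] in [W1], since
     otherwise it would have become a hub; the rest lie in [C2]. A vertex of [C2] has at most k - 1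
     neighbours in [W2]. *)
  apply: (@double_count _ G) => [w wW2|c cC2]; last first.
    rewrite -ltnS prednK; last exact: ltnW.
    have [cN|cN] := boolP (c \in N2); last exact: max2.
    rewrite (_ : [set _ in _ | _] = set0) ?cards0 ?(ltnW k1) //.
    apply/setP => w; rewrite !inE; apply/negP => /andP[wW].
    by apply/negP; apply: nadj2.
  have wW1 := subsetP W2W1 _ wW2; have wH := subsetP W1H _ wW1.
  have wM : w \notin M by apply: contraL wW1; apply: MW1.
  have [wu wN1] : w != u /\ w \notin N1 by apply/norP; move: wM; rewrite !inE.
  have nGw : G u w = false by apply/negbTE; apply: contraL wH; apply: GH.
  have := max1 w; rewrite !inE wu wN1 /tau nGw => /(_ isT isT) small.
  have sub : [set y | G w y] \subset
      [set y in W1 | G w y] :|: [set y in C2 | G w y].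
    apply/subsetP => y; rewrite !inE => Gwy; rewrite Gwy !andbT.
    have [//|yW1] /= := boolP (y \in W1); rewrite negb_or; apply/andP; split.
      by apply: contraTneq Gwy => ->; rewrite adj_sym nGw.
    by apply: contraTN Gwy => yN; rewrite adj_sym; apply: nadj1.
  have := leq_trans (hmin w wH) (leq_trans (subset_leq_card sub) (leq_card_setU _ _)).
  move: small; rewrite -/s; move: #|_| #|_| => a b; clear; lia.
(* Movable vertices are those reached in the first round except [u] and [Q]. Leaving out [Q] gives
   [hub_depth]: a hub in [A] is adjacent to [u], hence a child of [u]. *)
pose A := ~: (W1 :|: (u |: Q)).
have inA a : (a \in A) = [&& a \notin W1, a != u & a \notin Q].
  by rewrite in_setC in_setU in_setU1 !negb_or.
have parA a : a \in A -> [/\ f2 a = f1 a, f1 a != a & f1 a \in M].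
  rewrite inA => /and3P[aW1 au aQ]; rewrite old2 //.
  suff fa : f1 a != a by have [] := f1M _ fa.
  have [aH|aH] := boolP (a \in H); last by rewrite f1u ?notH // eq_sym.
  by apply: nonroot1 => //; apply: contra aQ => aN; rewrite inE aN.
have f2G x : f2 x != x -> G (f2 x) x.
  have [xW|xW] := boolP (x \in W1); first by move=> fx; have [] := par2 x xW fx.
  by rewrite old2 // => fx; have [] := f1M x fx.
have MA : #|M :\: A| <= #|Q|.+1.
  apply: (@leq_trans #|u |: Q|); last by rewrite cardsU1; case: (_ \notin _).
  apply/subset_leq_card/subsetP => z; rewrite in_setD inA => /andP[+ zM].
  by rewrite (MW1 _ zM) /= in_setU1; case: eqVneq => //= _; rewrite negbK.
apply: (@link_components V G M A f2 u S k (#|Q| + #|W2|) (parent_graph f2) set0) => //.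
- split=> [a /parA[-> _]//||a aA].
    by rewrite inA eqxx andbF.
  have [ea _ aM] := parA a aA; rewrite ea => pA; have [-> _ _] := parA _ pA.
  move: pA; rewrite inA => /and3P[_ pu pQ]; apply: f1u; apply: QN1 => //.
  by move: aM; rewrite in_setU1 (negbTE pu).
- move=> x xM.
  have [xu xN1] : x != u /\ x \notin N1 by apply/norP; move: xM; rewrite !inE.
  (* The neighbours of x outside [A] are fewer than [tau x] unreached ones and at most |Q| + 1
     others. As |Q| and k are at most d/32, enough remain in [A] both when x has degree at least d
     and threshold [t], and when it has degree at least D and threshold [s]. *)
  have := max1 x; rewrite in_setC1 xu xN1 => /(_ isT isT) small.
  have sub : [set y | G x y] \subset
      [set y in W1 | G x y] :|: (u |: Q) :|: [set a in A | G x a].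
    apply/subsetP => y; rewrite inE => Gxy.
    rewrite 2!in_setU [y \in [set _ in W1 | _]]inE [y \in [set _ in A | _]]inE Gxy !andbT.
    by rewrite in_setC -in_setU orbN.
  have c1 := leq_trans (subset_leq_card sub) (leq_card_setU _ _).
  have c2 := leq_trans c1 (leq_add (leq_card_setU _ _) (leqnn _)).
  have c3 : #|u |: Q| <= #|Q|.+1 by rewrite cardsU1; case: (_ \notin _).
  have dx : degree G x <= #|[set y in W1 | G x y]| + #|u |: Q| + #|[set a in A | G x a]|.
    exact: c2.
  have tx : (tau x = t) \/ (tau x = s /\ D <= degree G x).
    rewrite /tau; case: ifPn => Gx; [by left | right; split=> //].
    by apply: hmin; rewrite Hdef xu.
  have dux := umin x.
  move: small tx dux dx c3 hm32 hk32 MA dD k1; rewrite /t /s /S.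
  move: #|_| #|_| #|_| #|_| #|_| (degree G x) (tau x); clear.
  by move=> *; rewrite -addnn; lia.
- split.
  + exact: forest_parent_graph.
  + move=> x y /= /andP[nxy /orP[]/eqP e]; rewrite -e in nxy *; last exact: f2G.
    by rewrite adj_sym f2G // eq_sym.
  + move=> a; rewrite setD0 => /parA[ea fa _].
    by rewrite /= /parent_rel ea fa eqxx orbT.
  + move=> z zM; rewrite cards0 addn0 degree_parent_graph //.
    apply: leq_trans (leq_addr _ _).
    (* The second round gives new parents only to vertices of [W1], which were roots, so no hub
       loses a child. *)
    have sub12 : children f1 z \subset children f2 z.
      apply/subsetP => b; rewrite !inE => /andP[bz /eqP fb]; rewrite bz old2 ?fb ?eqxx //.
      by apply: contraNN bz => /root1 <-; rewrite fb.
    apply: leq_trans (subset_leq_card sub12).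
    have [zu|zu] := eqVneq z u.
      apply: (@leq_trans d); first by rewrite /S; move: hk32; clear; lia.
      rewrite ed zu; apply/subset_leq_card/subsetP => b; rewrite inE => Gb.
      rewrite inE f1u // eqxx andbT; apply: contraTneq Gb => ->.
      by rewrite adj_irr.
    have zN : z \in N1 by move: zM; rewrite in_setU1 (negbTE zu).
    apply: leq_trans (chil1 z zN); rewrite /tau; case: ifP => // _.
    by rewrite /S /s; move: hk32 dD; clear; lia.
(* Every root is [u], a hub in [Q], or a vertex still isolated in [W2]. *)
- apply: has_reps_parent_graph => //.
  apply: (@leq_trans #|(u |: Q) :|: W2|); last first.
    apply: leq_trans (leq_card_setU _ _) _; rewrite -addSn leq_add2r.
    by rewrite cardsU1; case: (_ \notin _).
  apply/subset_leq_card/subsetP => v; rewrite inE => /eqP fv.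
  rewrite in_setU; apply/norP => -[vQ vW2].
  have vW1 : v \notin W1.
    apply/negP => vW1; have vN2 : v \notin N2 by apply: contraL vW1; apply: N2W1.
    by have := nonroot2 v vW1 vW2 vN2; rewrite fv eqxx.
  have vA : v \in A by rewrite in_setC in_setU negb_or vW1.
  by have [e + _] := parA v vA; rewrite -e fv eqxx.
- by rewrite cards0.
- move=> v vM; rewrite degree_parent_graph //.
  (* A vertex chosen in the second round has k children and a parent; any other vertex outside [M]
     has no child, hence degree at most 1. *)
  have [vN2|vN2] := boolP (v \in N2).
    have vA : v \in A.
      rewrite inA N2W1 //=; apply/andP; split.
        by apply: contraNneq vM => ->; rewrite in_setU1 eqxx.
      by apply: contra vM; rewrite inE => /andP[vN _]; rewrite in_setU1 vN orbT.
    have [e fv _] := parA v vA; rewrite e fv.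
    by have := chil2 v vN2; clear; lia.
  have -> : children f2 v = set0.
    apply/setP => b; rewrite !inE; apply/negP => /andP[bv /eqP fb].
    have [bW|bW] := boolP (b \in W1).
      have := par2 b bW; rewrite fb eq_sym bv => /(_ isT)[vN _].
      by rewrite vN in vN2.
    by have := f1M b; rewrite -old2 // fb eq_sym bv => /(_ isT)[]; rewrite (negbTE vM).
  by rewrite cards0; case: (f2 v != v).
Qed.

(** * The estimate of p_k and the theorem *)

Local Open Scope ring_scope.

(* Crude: drop the last summands, and use sqrt (2k) >= 2. *)
Lemma p_ge (R : rcfType) (k : nat) :
  (1 < k)%N -> (32 * (k * k.-1))%N%:R <= p_ R k.
Proof.
case: k => [|[|q]] // _; rewrite /p_; set k := q.+2.
have k2 : 2 <= k%:R :> R by rewrite ler_nat.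
have s2 : 2 <= Num.sqrt (2 * k%:R) :> R.
  rewrite -[leLHS]ger0_norm // -sqrtr_sqr ler_sqrt; nra.
have c0 : 0 <= c_ R k by apply: sqrtr_ge0.
have c2 : c_ R k ^+ 2 = k%:R * (k%:R - 1) * (k%:R + 2 * Num.sqrt (2 * k%:R) + 2).
  rewrite sqr_sqrtr //; apply: mulr_ge0; first by apply: mulr_ge0; lra.
  by lra.
have sc : c_ R k <= Num.sqrt (c_ R k ^+ 2 + 4 * k%:R ^+ 2 + 8 * k%:R + 4).
  rewrite -[leLHS]ger0_norm // -sqrtr_sqr ler_sqrt; nra.
(* The inner root in [p_] is at least c, so the fraction is at least (5 c^2 + 3 c^2) / 2 = 4 c^2,
   while c^2 >= 8 k (k - 1). *)
have -> : (32 * (k * k.-1))%N%:R = 4 * (k%:R * (k%:R - 1) * 8) :> R.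
  by rewrite !natrM -subn1 natrB //; lra.
have c8 : k%:R * (k%:R - 1) * 8 <= c_ R k ^+ 2.
  rewrite c2; apply: ler_wpM2l; last by lra.
  by apply: mulr_ge0; lra.
have : c_ R k ^+ 2 <= c_ R k * Num.sqrt (c_ R k ^+ 2 + 4 * k%:R ^+ 2 + 8 * k%:R + 4).
  by rewrite expr2; apply: ler_wpM2l.
have : 0 <= k%:R ^+ 2 :> R by apply: sqr_ge0.
by lra.
Qed.

Theorem theorem1p3 (R : rcfType) (k : nat) (hk : (2 <= k)%N)
    (V : finType) (G : sgraph V) (hG : connected G) (hn : (k + 2 <= #|V|)%N)
    (hpi : ((p_ R k * #|V|%:R)%:E <= pi2 R G)%E) :
  exists S : sgraph V, is_2k_ST k G S.
Proof.
apply: product_2k_ST => // x y nxy nG.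
rewrite -(ler_nat R) natrM.
apply: (@le_trans _ _ (p_ R k * #|V|%:R)).
  by apply: ler_wpM2r (p_ge R hk); apply: ler0n.
rewrite -lee_fin; apply: le_trans hpi _.
by apply: (@bigmin_le_cond _ _ _ _ (x, y)); rewrite /= nxy.
Qed.
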